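(* Let $\Omega\subseteq\mathbb{R}^n$ be open, let $g:\Omega\to\mathbb{R}$ be integrable, let $\mathbf{X}$ be a continuous random vector with values in $\Omega$ and probability density function $f_{\mathbf{X}}$, let $Y=g(\mathbf{X})$ and $d\ge0$. Denote the set of all open subsets of $\Omega$ by $\tau$, and define $\lambda:\tau\to[0,\infty]$ by $\lambda(\Gamma)=\mathrm{PEACE}_d(\mathbf{X}|_{\Gamma}\to Y)$. Define $\mu:\mathcal{P}(\Omega)\to[0,\infty]$ on the power set of $\Omega$ by $$\mu(E):=\inf\{\lambda(\Gamma):\ E\subseteq\Gamma,\ \Gamma\in\tau\}.$$ Then $\mu$ is an outer measure on $\Omega$. Moreover, $\mu$ is a Borel regular measure; that is, every Borel subset of $\Omega$ is $\mu$-measurable (so that $\mu$ restricts to a measure on the Borel $\sigma$-algebra of $\Omega$), and $\mu$ is Borel regular.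
   Context: $|\cdot|$ is the Euclidean norm; $C_c^1(\Gamma,\mathbb{R}^n)$ is the set of compactly supported continuously differentiable functions $\Gamma\to\mathbb{R}^n$. For an open set $\Gamma\subseteq\Omega$, $$\mathrm{PEACE}_d(\mathbf{X}|_{\Gamma}\to Y):=\sup\left\{\int_{\Gamma} g\,\mathrm{div}(\varphi)\,\mathrm{d}\mathbf{x}:\ \varphi\in C_c^1(\Gamma,\mathbb{R}^n),\ |\varphi|\le f_{\mathbf{X}}^{2d}\text{ on }\Gamma\right\}\in[0,\infty],$$ where $f_{\mathbf X}$ is the (unnormalized) restriction to $\Gamma$ of the density of $\mathbf X$. An outer measure is a function $\mu:\mathcal P(\Omega)\to[0,\infty]$ with $\mu(\emptyset)=0$ that is monotone and countably subadditive; $E$ is $\mu$-measurable if $\mu(A)=\mu(A\cap E)+\mu(A\setminus E)$ for all $A\subseteq\Omega$. $\mu$ is called Borel regular if for any $A\subseteq\Omega$ there exists a Borel set $E$ in $\Omega$ with $\mu(A)=\mu(E)$. Convention: $t^0=1$ for all $t\ge 0$. *)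

(* Defs.v *)
From HB Require Import structures.
From mathcomp Require Import all_boot all_order all_algebra.
From mathcomp Require Import all_classical all_reals all_analysis.

Set Implicit Arguments.
Unset Strict Implicit.
Unset Printing Implicit Defensive.

Import Order.TTheory GRing.Theory Num.Theory.
Import numFieldNormedType.Exports.

Local Open Scope classical_set_scope.
Local Open Scope ring_scope.

(** * Lebesgue measure on R^n, n >= 1 (written 'rV_n.+1)

   Lebesgue outer measure is the infimum of the total volumes of countable
   covers by half-open boxes.  The Lebesgue sigma-algebra and Lebesgue measure
   are its Caratheodory sigma-algebra and its restriction to it. *)

Section lebesgue_rV.
Context {R : realType} {n : nat}.
Local Notation V := 'rV[R]_n.+1.

Definition hobox (ab : V * V) : set V :=
  [set x | forall i, x 0 i \in `[ab.1 0 i, ab.2 0 i[].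

Definition hobox_vol (ab : V * V) : R :=
  \prod_i Num.max 0 (ab.2 0 i - ab.1 0 i).

Local Open Scope ereal_scope.

Definition lebesgue_outer (A : set V) : \bar R :=
  ereal_inf [set \sum_(k <oo) (hobox_vol (F k))%:E
            | F in [set F : (V * V)^nat | A `<=` \bigcup_k hobox (F k)]].

Lemma hobox_vol_ge0 (ab : V * V) : (0 <= hobox_vol ab)%R.
Proof. by apply: prodr_ge0 => i _; rewrite le_max lexx. Qed.

Let vol_ge0 (F : (V * V)^nat) k : 0 <= (hobox_vol (F k))%:E.
Proof. by rewrite lee_fin hobox_vol_ge0. Qed.

Let lebesgue_outer_ge0 A : 0 <= lebesgue_outer A.
Proof. by apply: le_ereal_inf_tmp => _ [F _ <-]; exact: nneseries_ge0. Qed.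

Let lebesgue_outer0 : lebesgue_outer set0 = 0.
Proof.
apply/eqP; rewrite eq_le lebesgue_outer_ge0 andbT.
apply: ereal_inf_lbound; exists (fun=> (0%R, 0%R)) => //.
apply: eseries0 => k _ _; congr (_%:E); apply/eqP/prodf_eq0.
by exists ord0 => //=; rewrite subrr maxxx.
Qed.

Let le_lebesgue_outer :
  {homo lebesgue_outer : A B / A `<=` B >-> A <= B}.
Proof.
move=> A B AB; apply: ereal_inf_le_tmp => _ [F /= BF <-].
by exists F => //; exact: subset_trans BF.
Qed.

Let lebesgue_outer_sigma_subadditive : sigma_subadditive lebesgue_outer.
Proof.
move=> A; have [[i ioo]|] := pselect (exists i, lebesgue_outer (A i) = +oo).
  rewrite (eseries_pinfty _ _ ioo) ?leey// => k _.
  by rewrite -ltNye (lt_le_trans _ (lebesgue_outer_ge0 _)).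
rewrite -forallNE => Aoo.
apply/lee_addgt0Pr => e e0.
rewrite (le_trans _ (epsilon_trick _ _ (ltW e0)))//.
pose Q k (B : (V * V)^nat) := A k `<=` \bigcup_j hobox (B j) /\
  \sum_(j <oo) (hobox_vol (B j))%:E
    <= lebesgue_outer (A k) + (e / (2 ^ k.+1)%:R)%:E.
have [G QG] : {G : ((V * V)^nat)^nat & forall k, Q k (G k)}.
  apply: (@choice _ _ Q) => k.
  have ek : (0 < e / (2 ^ k.+1)%:R)%R by rewrite divr_gt0// ltr0n expn_gt0.
  have fA : lebesgue_outer (A k) \is a fin_num.
    by rewrite ge0_fin_numE// ltey; apply/eqP; exact: Aoo.
  have [_ [B AB <-] Be] := lb_ereal_inf_adherent ek fA.
  by exists B; split => //; exact/ltW.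
have /card_esym/ppcard_eqP[f] := card_nat2.
pose H (ij : nat * nat) := (hobox_vol (G ij.1 ij.2))%:E.
have H0 ij : 0 <= H ij by exact: vol_ge0.
apply: (@le_trans _ _ (\esum_(ij in [set: nat * nat]) H ij)).
  apply: ereal_inf_lbound => /=; exists (fun k => G (f k).1 (f k).2).
    move=> x [i _ /(QG i).1[j _ xij]].
    by exists (f^-1%FUN (i, j)) => //; rewrite invK ?inE.
  rewrite nneseries_esumT; last by move=> k; exact: (H0 (f k)).
  by rewrite (reindex_esum [set: nat] [set: nat * nat] f).
rewrite (_ : [set: nat * nat] = [set: nat] `*`` (fun=> [set: nat])); last first.
  by apply/seteqP; split.
rewrite -(esum_esum (a := fun i j => H (i, j)))//.
have HG i : \esum_(j in setT) H (i, j) = \sum_(j <oo) (hobox_vol (G i j))%:E.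
  by rewrite -nneseries_esumT.
under eq_esum do rewrite HG.
have G0 i : 0 <= \sum_(j <oo) (hobox_vol (G i j))%:E.
  by apply: nneseries_ge0 => j _ _; exact: (H0 (i, j)).
rewrite -nneseries_esumT//; apply: lee_nneseries => i // _.
exact: (QG i).2.
Qed.

HB.instance Definition _ := isOuterMeasure.Build R V lebesgue_outer
  lebesgue_outer0 lebesgue_outer_ge0 le_lebesgue_outer
  lebesgue_outer_sigma_subadditive.

Definition lebesgue_outer_measure : {outer_measure set V -> \bar R} :=
  lebesgue_outer.

End lebesgue_rV.

(* R^(n+1) with the Lebesgue sigma-algebra *)
Notation lebesgue_rV R n := (caratheodory_type (@lebesgue_outer_measure R n)).

Definition lebesgue_measure_rV (R : realType) (n : nat) :
  {measure set (lebesgue_rV R n) -> \bar R} := @lebesgue_outer_measure R n.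

(* R^(n+1) with the Borel sigma-algebra *)
Notation borel_rV R n := (g_sigma_algebraType (@open 'rV[R]_n.+1)).

Section peace.
Context {R : realType} {n : nat}.
Local Notation V := 'rV[R]_n.+1.
Local Notation leb := (lebesgue_measure_rV R n).

(* The library norm `|v| on row vectors is the sup norm. *)
Definition enorm (v : V) : R := Num.sqrt (\sum_i (v 0 i) ^+ 2).

Definition divergence (phi : V -> V) (x : V) : R :=
  \sum_i 'D_(delta_mx 0 i) (fun y => phi y 0 i) x.

(* Only the values of [phi] on the open set [G] matter. *)
Definition C1c (G : set V) (phi : V -> V) : Prop :=
  let supp := closure [set x | G x /\ phi x != 0] in
  [/\ forall x, G x -> differentiable phi x,
      forall x, G x -> {for x, continuous (jacobian phi)},
      compact supp
    & supp `<=` G].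

(* [f] is a density, with respect to Lebesgue measure on [Om], of the law of the
   random vector [X] taking values in [Om]. *)
Definition is_pdf_on d (T : measurableType d) (P : probability T R)
    (X : {RV P >-> borel_rV R n}) (Om : set V) (f : V -> R) : Prop :=
  [/\ measurable_fun (Om : set (lebesgue_rV R n)) f,
      forall x, Om x -> 0 <= f x
    & forall B : set (borel_rV R n), measurable B ->
        distribution P X B = (\int[leb]_(x in Om `&` B) (f x)%:E)%E].

(* PEACE_d(X|_G -> g(X)) for [X] with density [f]; [powR] has 0 `^ 0 = 1. *)
Definition PEACE (d : R) (f g : V -> R) (G : set V) : \bar R :=
  ereal_sup [set (\int[leb]_(x in G) (g x * divergence phi x)%:E)%E
            | phi in [set phi | C1c G phi /\
                forall x, G x -> enorm (phi x) <= f x `^ (2 * d)]].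

(* Subsets of [Om] are sets over the subtype [set_type Om]. *)
Definition PEACE_outer (d : R) (Om : set V) (f g : V -> R)
    (E : set (set_type Om)) : \bar R :=
  ereal_inf [set PEACE d f g G
            | G in [set G | [/\ open G, G `<=` Om & set_val @` E `<=` G]]].

End peace.

(* The Borel sigma-algebra of a topological space. *)
Definition borel_set {T : topologicalType} : set (set T) := <<s @open T >>.

(* Main.v *)
(** Extending test fields by zero, [PEACE d f g G] becomes the supremum of
    [flux phi = \int_Om g div phi] over C^1 fields [phi] on the whole space with
    compact support in [G] and [|phi| <= f^(2d)].  A C^1 cutoff [z] splits a field
    supported in [G1 `|` G2] as [z phi + (1 - z) phi], so this supremum is
    subadditive, and countably subadditive by compactness of the support.  If [phi]
    is supported on a compact [K] of [A `&` W] and [psi] in [A `\` K], then [phi + psi]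
    is an admissible field of [A]; taking suprema over [psi] and then over [phi] gives
    the Caratheodory inequality for the open set [W].  A Borel set with the same outer
    measure as [A] is a countable intersection of open sets containing [A]. *)

Require Import Defs.
From HB Require Import structures.
From mathcomp Require Import all_boot all_order all_algebra.
From mathcomp Require Import all_classical all_reals all_analysis.
From mathcomp Require Import measurable_realfun ring lra.

Set Implicit Arguments.
Unset Strict Implicit.
Unset Printing Implicit Defensive.

Import Order.TTheory GRing.Theory Num.Theory.
Import numFieldNormedType.Exports.

Local Open Scope classical_set_scope.
Local Open Scope ring_scope.

(** * Open sets of R^n are Lebesgue measurable *)

Section lebesgue_borel.
Context {R : realType} {n : nat}.
Local Notation V := 'rV[R]_n.+1.
Local Notation leb := (lebesgue_rV R n).

(** Additivity of the length of [[a, b[] under a cut at [c]; the truncation at 0 also covers [c]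
    outside the interval and [b < a]. *)
Lemma max0_split (a b c : R) :
  Num.max 0 (b - a) =
  Num.max 0 (Num.min b c - a) + Num.max 0 (b - Num.max a c).
Proof.
by case: (leP b c) => ?; case: (leP a c) => ?; do ?[case: (leP 0) => ?]; lra.
Qed.

Lemma hobox_volE (i : 'I_n.+1) (a b : V) : hobox_vol (a, b) =
  Num.max 0 (b 0 i - a 0 i) * \prod_(j | j != i) Num.max 0 (b 0 j - a 0 j).
Proof. by rewrite /hobox_vol (bigD1 i). Qed.

(** The hyperplane [x 0 i = c] cuts each box of a cover into two boxes whose volumes add up. A cover
    of [A] thus yields covers of both pieces of [A] with the same total volume. *)
Lemma measurable_halfspace (i : 'I_n.+1) (c : R) :
  measurable ([set x : V | x 0 i < c] : set leb).
Proof.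
apply: le_caratheodory_measurable => A; apply: le_ereal_inf_tmp => _ [F /= AF <-].
pose upd (h : R -> R) (v : V) : V := \row_j if j == i then h (v 0 j) else v 0 j.
pose F1 k := ((F k).1, upd (Num.min^~ c) (F k).2).
pose F2 k := (upd (Num.max^~ c) (F k).1, (F k).2).
have volF k : hobox_vol (F k) = hobox_vol (F1 k) + hobox_vol (F2 k).
  rewrite [F k]surjective_pairing !(hobox_volE i) !mxE eqxx.
  rewrite (max0_split _ _ c) mulrDl; congr (_ * _ + _ * _);
    by apply: eq_bigr => j /negbTE ji; rewrite !mxE ji.
rewrite (_ : (\sum_(k <oo) _)%E = (\sum_(k <oo) (hobox_vol (F1 k))%:E +
    \sum_(k <oo) (hobox_vol (F2 k))%:E)%E); last first.
  rewrite -nneseriesD; try by move=> k _ _; rewrite lee_fin hobox_vol_ge0.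
  by apply: eq_eseriesr => k _; rewrite -EFinD -volF.
apply: leeD; apply: ereal_inf_lbound.
- exists F1 => // x [/AF[k _ Fx]] /= xc; exists k => // j.
  have := Fx j; rewrite !in_itv/= mxE => /andP[-> xb] /=.
  by case: eqP => [ji|//]; rewrite lt_min xb/= ji.
- exists F2 => // x [/AF[k _ Fx]] /= /negP; rewrite -leNgt => xc; exists k => // j.
  have := Fx j; rewrite !in_itv/= mxE => /andP[ax ->] /=; rewrite andbT.
  by case: eqP => [ji|//]; rewrite ge_max ax/= ji.
Qed.

Lemma measurable_hobox (ab : V * V) : measurable (hobox ab : set leb).
Proof.
rewrite (_ : hobox ab = \bigcap_(i in [set: 'I_n.+1])
    ([set x : V | x 0 i < ab.2 0 i] `&` ~` [set x : V | x 0 i < ab.1 0 i])).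
  apply: fin_bigcap_measurable => // i _; apply: measurableI.
    exact: measurable_halfspace.
  by apply: measurableC; exact: measurable_halfspace.
apply/seteqP; split => x h i.
  by move=> _; have := h i; rewrite in_itv/= leNgt => /andP[/negP].
by have [xb /negP] := h i I; rewrite -leNgt in_itv/= => ->.
Qed.

Lemma open_measurable_rV (G : set V) : open G -> measurable (G : set leb).
Proof.
move=> oG.
pose q2r (v : 'rV[rat]_n.+1) : V := map_mx ratr v.
pose box (ab : 'rV[rat]_n.+1 * 'rV[rat]_n.+1) : set V := hobox (q2r ab.1, q2r ab.2).
(* Boxes not contained in [G] are replaced by the empty set, so that the union ranges over a whole
   countable type. *)
pose F ab := if `[< box ab `<=` G >] then box ab else set0.
rewrite (_ : G = \bigcup_ab F ab); last first.
  apply/seteqP; split => x; last by move=> [ab _]; rewrite /F; case: asboolP => // h /h.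
  move=> Gx; have /nbhs_ballP[e /= e0 eG] : nbhs x G by exact: open_nbhs_nbhs.
  (* Corners less than [e] away from [x] in each coordinate keep the box inside the sup-norm ball of
     radius [e]. *)
  have below i : {q : rat | x 0 i - e < ratr q < x 0 i}.
    by apply/cid; have [|q] := @rat_in_itvoo R (x 0 i - e) (x 0 i); [lra|exists q].
  have above i : {q : rat | x 0 i < ratr q < x 0 i + e}.
    by apply/cid; have [|q] := @rat_in_itvoo R (x 0 i) (x 0 i + e); [lra|exists q].
  pose ab := (\row_i sval (below i), \row_i sval (above i)).
  exists ab => //; rewrite /F asboolT; last first.
    move=> y /= yab; apply: eG; split => // j i; rewrite ord1 {j}.
    have := yab i; rewrite !mxE in_itv/= /ball/= ltr_norml.
    have /andP[? ?] := svalP (below i); have /andP[? ?] := svalP (above i).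
    by move=> /andP[? ?]; apply/andP; split; lra.
  move=> i; rewrite !mxE in_itv/=.
  have /andP[_ /ltW ->] := svalP (below i).
  by have /andP[-> _] := svalP (above i).
apply: countable_bigcupT_measurable => // ab; rewrite /F.
by case: asboolP => // _; exact: measurable_hobox.
Qed.
End lebesgue_borel.

Lemma continuous_measurable_rV (R : realType) (n : nat) (D : set 'rV[R]_n.+1)
    (h : 'rV[R]_n.+1 -> R) :
  measurable (D : set (lebesgue_rV R n)) -> continuous h ->
  measurable_fun (D : set (lebesgue_rV R n)) h.
Proof.
move=> mD /continuousP ch; apply: (measurability _ (RGenOpens.measurableE R)).
move=> _ [_ [a [b ->] <-]]; apply: measurableI => //.
by apply: open_measurable_rV; exact/ch/interval_open.
Qed.

(** * Continuously differentiable maps *)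

Section C1.
Context {R : realType}.

(** Continuity of the differential is asked direction by direction, which needs no topology on
    linear maps and is the usual notion when [V] is finite-dimensional. *)
Definition C1 (V W : normedModType R) (f : V -> W) : Prop :=
  exists2 df : V -> V -> W, forall x, is_diff x f (df x)
                          & forall v, continuous (fun x => df x v).

(** The first-order expansion of [f] at [x] is also one of [g], and differentials are unique. *)
Lemma near_eq_is_diff (V W : normedModType R) (f g df : V -> W) (x : V) :
  (\forall y \near x, f y = g y) -> is_diff x f df -> is_diff x g df.
Proof.
move=> fg [dfx <-]; have dfc := diff_continuous dfx.
have gE : g \o shift x = cst (g x) + 'd f x +o_ 0 id.
  apply/eqaddoP => e e0; have /eqaddoP/(_ e e0) := diff_locally dfx.
  rewrite !near_simpl => fo; near=> h; rewrite /= -(nbhs_singleton fg).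
  rewrite !fctE /= -[g _](_ : f (h + x) = _); first by near: h.
  near: h; have := fg; rewrite (near_shift 0); apply: filterS => y /=.
  by rewrite subr0.
have dgE : 'd g x = 'd f x :> (V -> W) by exact: diff_unique.
apply: DiffDef; last exact: dgE.
by apply/diff_locallyP; rewrite dgE; split; [exact: dfc|exact: gE].
Unshelve. all: by end_near. Qed.

Lemma C1_cst (V W : normedModType R) (a : W) : C1 (fun _ : V => a).
Proof.
exists (fun _ _ => 0) => [x|v]; first exact: is_diff_cst.
exact: cst_continuous.
Qed.

Lemma C1D (V W : normedModType R) (f g : V -> W) :
  C1 f -> C1 g -> C1 (fun x => f x + g x).
Proof.
move=> [df hf cf] [dg hg cg]; exists (fun x v => df x v + dg x v) => [x|v x].
  exact: is_diffD.
by apply: cvgD; [exact: cf|exact: cg].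
Qed.

Lemma C1_sum (V W : normedModType R) (I : Type) (r : seq I) (f : I -> V -> W) :
  (forall i, C1 (f i)) -> C1 (fun x => \sum_(i <- r) f i x).
Proof.
move=> fC1; elim: r => [|i r IHr].
  by under eq_fun do rewrite big_nil; exact: C1_cst.
by under eq_fun do rewrite big_cons; exact: C1D.
Qed.

(** The product rule, as the chain rule for the pair [(k, f)] followed by the continuous bilinear
    map of scaling. *)
Lemma is_diff_scale (V W : normedModType R) (k dk : V -> R) (f df : V -> W) (x : V) :
  is_diff x k dk -> is_diff x f df ->
  is_diff x (fun y => k y *: f y) (fun v => k x *: df v + dk v *: f x).
Proof.
move=> hk hf.
have bil : bilinear_for (GRing.Scale.Law.clone _ _ *:%R _)
    (GRing.Scale.Law.clone _ _ *:%R _) (@GRing.scale R W).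
  split=> [u'|u] a y z /=; first by rewrite scalerDl scalerA.
  by rewrite scalerDr !scalerA mulrC.
pose bM := bilinear_isBilinear.Build R R W W _ _ _ bil.
pose b : {bilinear R -> W -> W} := HB.pack (@GRing.scale R W) bM.
have cb : continuous (fun p : R * W => b p.1 p.2) by exact: scale_continuous.
have hb : is_diff (k x, f x) (fun p : R * W => b p.1 p.2)
    (fun q => k x *: q.2 + q.1 *: f x).
  apply: DiffDef; first exact: differentiable_bilin.
  exact: diff_bilin.
exact: (is_diff_comp (is_diff_pair hk hf) hb).
Qed.

Lemma C1Z (V W : normedModType R) (k : V -> R) (f : V -> W) :
  C1 k -> C1 f -> C1 (fun x => k x *: f x).
Proof.
move=> [dk hk ck] [df hf cf].
exists (fun x v => k x *: df x v + dk x v *: f x) => [x|v x].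
  exact: is_diff_scale.
apply: cvgD; apply: cvgZ.
- by apply: differentiable_continuous; case: (hk x).
- exact: cf.
- exact: ck.
- by apply: differentiable_continuous; case: (hf x).
Qed.

Lemma C1M (V : normedModType R) (f g : V -> R) :
  C1 f -> C1 g -> C1 (fun x => f x * g x).
Proof. exact: C1Z. Qed.

Lemma C1_comp (V : normedModType R) (q : V -> R) (h : R -> R) :
  C1 q -> C1 h -> C1 (fun x => h (q x)).
Proof.
move=> [dq hq cq] [dh hh ch].
(* A linear map on the line is multiplication by its value at 1; this turns the composed
   differential into a product of two continuous functions. *)
have hhE t s : dh t s = s * dh t 1.
  have [_ <-] := hh t; rewrite -[in LHS](mulr1 s); exact: linearZ.
exists (fun x v => dq x v * dh (q x) 1) => [x|v x].
  rewrite (_ : (fun v => _ * _) = dh (q x) \o dq x); last first.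
    by apply/funext => v; exact/esym/hhE.
  exact: (is_diff_comp (hq x) (hh (q x))).
apply: cvgM; first exact: cq.
apply: (@continuous_comp _ _ _ q (fun t => dh t 1)); last exact: ch.
by apply: differentiable_continuous; case: (hq x).
Qed.

Lemma is_diff_coord n (i : 'I_n.+1) (x : 'rV[R]_n.+1) :
  is_diff x (fun y : 'rV[R]_n.+1 => y 0 i) (fun y => y 0 i).
Proof.
have lin : linear (fun x : 'rV[R]_n.+1 => x 0 i : R^o).
  by move=> a y z; rewrite !mxE.
pose lM := GRing.isLinear.Build _ _ _ _ _ lin.
pose l : {linear 'rV[R]_n.+1 -> R} := HB.pack (fun x : 'rV[R]_n.+1 => x 0 i) lM.
have cl : continuous l by exact: coord_continuous.
apply: DiffDef; first exact: differentiable_coord.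
exact: (diff_lin _ cl).
Qed.

Lemma C1_coord n (i : 'I_n.+1) : C1 (fun x : 'rV[R]_n.+1 => x 0 i).
Proof.
exists (fun _ (v : 'rV[R]_n.+1) => v 0 i) => [x|v]; first exact: is_diff_coord.
exact: cst_continuous.
Qed.

(** Squaring smooths the corner of the positive part: the derivative [2 * Num.max 0 t] is
    continuous. This is the building block of the cutoffs. *)
Lemma C1_sqr_max0 : C1 (fun t : R => Num.max 0 t ^+ 2).
Proof.
pose m t : R := Num.max 0 t ^+ 2.
(* A remainder quadratic in [h], uniformly in [t], gives the little-o expansion. *)
have est (t h : R) : `|m (h + t) - m t - h * (2 * Num.max 0 t)| <= h ^+ 2.
  rewrite /m ler_norml; case: (leP 0 (h + t)) => ?; case: (leP 0 t) => ?;
    apply/andP; split; nra.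
have lin (a : R) : linear (fun x : R => x * a : R^o).
  by move=> c x y; rewrite mulrDl -mulrA.
pose l (a : R) : {linear R -> R} :=
  HB.pack (fun x : R => x * a) (GRing.isLinear.Build _ _ _ _ _ (lin a)).
pose dm (t : R) := l (2 * Num.max 0 t).
have dmc t : continuous (dm t) by move=> x; apply: cvgMl; exact: cvg_id.
have mE t : m \o shift t = cst (m t) + dm t +o_ 0 id.
  apply/eqaddoP => e e0; near=> h; rewrite !fctE /= opprD addrA.
  apply: (le_trans (est t h)); rewrite -(real_normK (num_real h)) expr2.
  apply: ler_wpM2r => //; near: h; exact: nbhs0_le.
have dE t : 'd m t = dm t :> (R -> R) by exact: diff_unique.
exists (fun t v => v * (2 * Num.max 0 t)) => [t|v t].
  by apply: DiffDef; [apply/diff_locallyP; rewrite dE|exact: dE].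
apply: cvgMr; apply: cvgMr; apply: continuous_max => //.
exact: cvg_cst.
Unshelve. all: by end_near. Qed.
End C1.

(** * Jacobian and divergence *)

Section jacobian.
Context {R : realType} {n : nat}.
Local Notation V := 'rV[R]_n.+1.

Lemma cvg_mx (T : Type) (F : set_system T) (FF : Filter F) p q
    (f : T -> 'M[R]_(p, q)) (M : 'M[R]_(p, q)) :
  (forall i j, (fun x => f x i j) @ F --> M i j) -> f @ F --> M.
Proof.
move=> fM A [P PM PA]; apply: (@filterS _ F _ _ _ (fun x h => PA (f x) h)).
apply: filter_forall => i; apply: filter_forall => j; exact: (fM i j).
Qed.

Lemma cvg_sum (T : Type) (F : set_system T) (FF : Filter F) (I : Type) (r : seq I)
    (f : I -> T -> R) (a : I -> R) :
  (forall i, f i @ F --> a i) ->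
  (fun x => \sum_(i <- r) f i x) @ F --> \sum_(i <- r) a i.
Proof. by move=> fa; apply: cvg_big => //; exact: add_continuous. Qed.

Lemma diff_jacobian (phi : V -> V) (x v : V) :
  'd phi x v = v *m jacobian phi x.
Proof. by rewrite /jacobian mul_rV_lin1. Qed.

Lemma continuous_mx (T : topologicalType) p q (f : T -> 'M[R]_(p, q)) (x : T) :
  (forall i j, {for x, continuous (fun y => f y i j)}) -> {for x, continuous f}.
Proof. by move=> fx; exact: (@cvg_mx T (nbhs x) _ p q f (f x)). Qed.

Lemma continuous_entry (T : topologicalType) p q (f : T -> 'M[R]_(p, q)) (x : T) i j :
  {for x, continuous f} -> {for x, continuous (fun y => f y i j)}.
Proof. by move=> fx; exact: (continuous_comp fx (@coord_continuous _ _ _ i j _)). Qed.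

(** Bridge between [C1c], phrased with the Jacobian matrix, and [C1], phrased with directions: the
    rows of the Jacobian are the differentials along basis vectors. *)
Lemma continuous_jacobianP (phi : V -> V) (x : V) :
  {for x, continuous (jacobian phi)} <->
  forall v, {for x, continuous (fun y => 'd phi y v)}.
Proof.
split=> [cJ v|cd].
  rewrite (_ : (fun y => _) = fun y => v *m jacobian phi y); last first.
    by apply/funext => y; rewrite diff_jacobian.
  apply: continuous_mx => i j.
  rewrite (_ : (fun y => _) = fun y => \sum_k v i k * jacobian phi y k j); last first.
    by apply/funext => y; rewrite mxE.
  apply: (@cvg_sum V (nbhs x)) => k; apply: cvgMr.
  exact: (continuous_entry cJ).
apply: continuous_mx => i j.
rewrite (_ : (fun y => _) = fun y => ('d phi y (delta_mx 0 i)) 0 j); last first.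
  by apply/funext => y; rewrite diff_jacobian -rowE [RHS]mxE.
exact: (continuous_entry (cd _)).
Qed.

Lemma divergenceE (phi : V -> V) (dphi : V -> V) (x : V) : is_diff x phi dphi ->
  divergence phi x = \sum_i (dphi (delta_mx 0 i)) 0 i.
Proof.
move=> hphi; apply: eq_bigr => i _.
have [hd hE] := is_diff_comp hphi (is_diff_coord i (phi x)).
by rewrite (deriveE _ hd); exact: (congr1 (fun l => l _) hE).
Qed.

Lemma continuous_divergence (phi : V -> V) : C1 phi -> continuous (divergence phi).
Proof.
move=> [dphi hphi cphi].
rewrite (_ : divergence phi = fun x => \sum_i (dphi x (delta_mx 0 i)) 0 i).
  move=> x; apply: (@cvg_sum V (nbhs x)) => i.
  exact: (continuous_entry (cphi _ x)).
by apply/funext => x; exact: divergenceE.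
Qed.

Lemma divergenceD (phi psi : V -> V) (x : V) : C1 phi -> C1 psi ->
  divergence (fun y => phi y + psi y) x = divergence phi x + divergence psi x.
Proof.
move=> [dphi hphi _] [dpsi hpsi _].
rewrite (divergenceE (hphi x)) (divergenceE (hpsi x)).
rewrite (divergenceE (is_diffD (hphi x) (hpsi x))) -big_split/=.
by apply: eq_bigr => i _; rewrite mxE.
Qed.

Lemma divergence_near0 (phi : V -> V) (x : V) :
  (\forall y \near x, phi y = 0) -> divergence phi x = 0.
Proof.
move=> phi0.
have hphi : is_diff x phi (fun=> 0).
  apply: near_eq_is_diff (is_diff_cst 0 x).
  by apply: filterS phi0 => y ->.
by rewrite (divergenceE hphi) big1// => i _; rewrite mxE.
Qed.

Lemma near_eq_divergence (phi psi : V -> V) (x : V) : differentiable phi x ->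
  (\forall y \near x, phi y = psi y) -> divergence psi x = divergence phi x.
Proof.
move=> /differentiableP hphi e.
by rewrite (divergenceE hphi) (divergenceE (near_eq_is_diff e hphi)).
Qed.

End jacobian.

(** * Compactly supported cutoff functions *)

Section cutoff.
Context {R : realType} {n : nat}.
Local Notation V := 'rV[R]_n.+1.

Definition cutoff (G U : set V) (z : V -> R) : Prop :=
  [/\ C1 z, forall x, 0 <= z x <= 1, forall x, U x -> z x = 1
    & exists2 K, compact K /\ K `<=` G & forall x, ~ K x -> z x = 0].

Lemma compact_closed_ball (c : V) (r : R) : 0 < r -> compact (closed_ball c r).
Proof.
move=> r0; apply: bounded_closed_compact; last exact: closed_ball_closed.
exists (`|c| + r); split; first exact: num_real.
move=> M rM x /=; rewrite closed_ballE// /closed_ball_/= => cx.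
apply: le_trans (ltW rM); rewrite -[x](subKr c); apply: (le_trans (ler_normB _ _)).
by rewrite lerD2l.
Qed.

Lemma local_cutoff (G : set V) (c : V) : open G -> G c ->
  exists U z, [/\ open U, U c & cutoff G U z].
Proof.
move=> oG Gc; have /nbhs_closedballP[r rG] : nbhs c G by exact: open_nbhs_nbhs.
have r0 : 0 < r%:num by [].
pose m (t : R) := Num.max 0 t ^+ 2.
pose s (x : V) := \sum_i (x 0 i - c 0 i) ^+ 2.
(* The scaling makes [q c = -1], and [q >= 1] off the ball of radius [r], where a single coordinate
   already contributes more than [r ^ 2] to [s]. *)
pose q x := (2 / r%:num ^+ 2) * s x - 1.
have s_ge0 x : 0 <= s x by apply: sumr_ge0 => i _; exact: sqr_ge0.
have C1q : C1 q.
  apply: C1D; last exact: C1_cst.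
  apply: C1M; first exact: C1_cst.
  apply: C1_sum => i.
  by apply: C1M; (apply: C1D; [exact: C1_coord|exact: C1_cst]).
have cq : continuous q.
  by case: C1q => dq hq _ x; apply: differentiable_continuous; case: (hq x).
have m_ge0 t : 0 <= m t by exact: sqr_ge0.
have m0 t : t <= 0 -> m t = 0 by move=> t0; rewrite /m max_l ?expr0n.
(* [t |-> m (1 - m t)] is C^1, equals 1 for [t <= 0] and 0 for [t >= 1]. *)
exists [set x | q x < 0], (fun x => m (1 - m (q x))); split.
- rewrite (_ : [set x | q x < 0] = q @^-1` [set x | x < 0])//.
  by apply: open_comp => [x _|]; [exact: cq|exact: open_lt].
- by rewrite /= /q /s big1 ?mulr0 ?sub0r ?ltrN10// => i _; rewrite subrr expr0n.
split.
- apply: (C1_comp _ C1_sqr_max0); apply: C1D; first exact: C1_cst.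
  rewrite (_ : (fun x => _) = fun x => -1 * m (q x)); last first.
    by apply/funext => x; rewrite mulN1r.
  by apply: C1M; [exact: C1_cst|exact: (C1_comp C1q C1_sqr_max0)].
- move=> x; rewrite m_ge0/= /m; have := m_ge0 (q x); rewrite -/(m (q x)).
  by case: (leP 0 (1 - m (q x))) => ? ?; nra.
- move=> x /= /ltW/m0 ->; rewrite subr0 /m max_r ?expr1n//.
exists (closed_ball c r%:num); first by split; [exact: compact_closed_ball|].
move=> x xr; apply: m0; rewrite subr_le0.
(* The norm is the maximum of the coordinates, so a point off the closed ball has one coordinate too
   far from [c]. *)
have [i ri] : exists i, r%:num < `|x 0 i - c 0 i|.
  apply: contrapT => /forallNP ri; apply: xr.
  rewrite closed_ballE// /closed_ball_/= /Num.norm/= mx_normrE.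
  apply: bigmax_le => // -[j i] _ /=; rewrite !mxE ord1 distrC leNgt.
  exact/negP/ri.
have q1 : 1 <= q x.
  rewrite /q lerBrDr -mulrA ler_pMr ?ltr0n// ler_pdivlMl ?exprn_gt0//.
  rewrite mulr1 /s (bigD1 i)//= -[X in X <= _]addr0 lerD//; last first.
    by apply: sumr_ge0 => j _; exact: sqr_ge0.
  by rewrite -[leRHS]real_normK ?num_real// ler_sqr ?nnegrE// ltW.
by rewrite /m max_r ?(le_trans ler01)// expr_ge1// (le_trans ler01).
Qed.

(** The combination is [1 - (1 - z1) (1 - z2)]: it stays in [0, 1], is 1 as soon as one factor
    function is 1, and vanishes where both do. *)
Lemma cutoffU (G U1 U2 : set V) (z1 z2 : V -> R) :
  cutoff G U1 z1 -> cutoff G U2 z2 ->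
  cutoff G (U1 `|` U2) (fun x => z1 x + z2 x - z1 x * z2 x).
Proof.
move=> [C1z1 z1_01 z1U [K1 [cK1 K1G] z1K]] [C1z2 z2_01 z2U [K2 [cK2 K2G] z2K]].
split.
- apply: C1D; first exact: C1D.
  rewrite (_ : (fun x => _) = fun x => -1 * (z1 x * z2 x)); last first.
    by apply/funext => x; rewrite mulN1r.
  by apply: C1M; [exact: C1_cst|exact: C1M].
- move=> x; have /andP[? ?] := z1_01 x; have /andP[? ?] := z2_01 x.
  by apply/andP; split; nra.
- by move=> x [/z1U ->|/z2U ->]; ring.
- exists (K1 `|` K2); first by split; [exact: compactU|rewrite subUset].
  by move=> x /not_orP[/z1K -> /z2K ->]; ring.
Qed.

(** Finitely many local cutoffs cover [K] by compactness; they are merged one at a time with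
    [cutoffU]. *)
Lemma exists_cutoff (G K : set V) : open G -> compact K -> K `<=` G ->
  exists U z, [/\ open U, K `<=` U & cutoff G U z].
Proof.
move=> oG cK KG.
have /choice[U hU] c : exists U, K c -> [/\ open U, U c & exists z, cutoff G U z].
  have [Kc|nKc] := pselect (K c); last by exists set0.
  have [U [z [oU Uc zU]]] := local_cutoff oG (KG _ Kc).
  by exists U => _; split => //; exists z.
have [D DK KD] : finite_subset_cover K U K.
  move: cK; rewrite compact_cover; apply; first by move=> c /hU[].
  by move=> c Kc; exists c => //; have [] := hU c Kc.
pose s : seq V := finmap.enum_fset D.
have {}DK c : c \in s -> K c by move=> /DK; rewrite inE.
have {KD} Ks : K `<=` \bigcup_(c in [set` s]) U c by exact: KD.
exists (\bigcup_(c in [set` s]) U c).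
suff [z hz] : exists z, cutoff G (\bigcup_(c in [set` s]) U c) z.
  exists z; split => //; apply: bigcup_open => c /= cD.
  by have [] := hU c (DK c cD).
elim: s DK {Ks} => [|c s IHs] sK.
  exists (fun=> 0); split => [|x|x [c]|//]; first exact: C1_cst.
  - by rewrite lexx ler01.
  - by [].
  - by exists set0 => //; split => //; exact: compact0.
have [_ _ [z1 hz1]] := hU c (sK c (mem_head _ _)).
have [|z2 hz2] := IHs; first by move=> y ys; apply: sK; rewrite inE ys orbT.
exists (fun x => z1 x + z2 x - z1 x * z2 x).
have [? ? zU ?] := cutoffU hz1 hz2; split => // x [y /= ys Uyx]; apply: zU.
by move: ys; rewrite inE => /orP[/eqP <-|ys]; [left|right; exists y].
Qed.

End cutoff.

(** * The Euclidean norm *)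

Section enorm.
Context {R : realType} {n : nat}.
Implicit Type v : 'rV[R]_n.+1.

Lemma enorm0 : enorm (0 : 'rV[R]_n.+1) = 0.
Proof. by rewrite /enorm big1 ?sqrtr0// => i _; rewrite mxE expr0n. Qed.

Lemma enormZ_le (a : R) v : 0 <= a <= 1 -> enorm (a *: v) <= enorm v.
Proof.
move=> /andP[a0 a1]; apply: ler_wsqrtr; apply: ler_sum => i _.
by rewrite mxE exprMn ler_piMl ?sqr_ge0// expr_le1.
Qed.
End enorm.

(** * Admissible fields on the whole space and their flux *)

Section test_field.
Context {R : realType} {n : nat}.
Local Notation V := 'rV[R]_n.+1.
Local Notation leb := (lebesgue_measure_rV R n).
Implicit Types (w : V -> R) (G : set V) (phi psi : V -> V).

(** A compact [K] off which [phi] vanishes stands in for the support. The set [G] may be arbitrary,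
    for instance compact or a difference. *)
Definition test_field w G phi : Prop :=
  [/\ C1 phi, forall x, enorm (phi x) <= w x
    & exists2 K, compact K /\ K `<=` G & forall x, ~ K x -> phi x = 0].

Lemma compact_closed_rV (K : set V) : compact K -> closed K.
Proof. by apply: compact_closed; exact: norm_hausdorff. Qed.

Lemma near_off_compact (K : set V) x : compact K -> ~ K x ->
  \forall y \near x, ~ K y.
Proof.
move=> /compact_closed_rV/closed_openC oK Kx.
exact: (open_nbhs_nbhs (conj oK Kx)).
Qed.

Lemma test_field0 w G : (forall x, 0 <= w x) -> test_field w G (fun=> 0).
Proof.
move=> w0; split; first exact: C1_cst.
  by move=> x; rewrite enorm0.
by exists set0 => //; split => //; exact: compact0.
Qed.

Lemma near_eq_continuous (S T : topologicalType) (h k : S -> T) (x : S) :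
  (\forall y \near x, h y = k y) -> {for x, continuous h} -> {for x, continuous k}.
Proof.
move=> hk ch; rewrite /prop_for /continuous_at -(nbhs_singleton hk).
exact: cvg_trans (near_eq_cvg hk) ch.
Qed.

(** The extension by zero is C^1 because every point lies either in [G], where it agrees with [phi]
    nearby, or off the closed set [K], where it is zero nearby. *)
Lemma test_fieldP w G phi : open G -> (forall x, 0 <= w x) ->
  C1c G phi -> (forall x, G x -> enorm (phi x) <= w x) ->
  exists2 psi, test_field w G psi & forall x, G x -> psi x = phi x.
Proof.
move=> oG w0 [dphi Jphi cK KG] phiw; set K : set V := closure _ in cK KG.
pose psi (x : V) := if x \in K then phi x else 0.
have psiG x : G x -> psi x = phi x.
  move=> Gx; rewrite /psi; case: ifPn => // /negP; rewrite inE => nKx.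
  have [//|phi0] := eqVneq (phi x) 0.
  by exfalso; apply: nKx; apply: subset_closure.
have psiK x : ~ K x -> psi x = 0 by move=> nKx; rewrite /psi memNset.
have nearG x : G x -> \forall y \near x, G y by move=> Gx; exact: open_nbhs_nbhs.
have near_phi x : G x -> \forall y \near x, phi y = psi y.
  by move=> /nearG; apply: filterS => y /psiG.
have near_0 x : ~ K x -> \forall y \near x, 0 = psi y.
  by move=> /(near_off_compact cK); apply: filterS => y /psiK.
(* On [G] off [K] the differential of [phi] vanishes, so [dpsi] agrees with it on all of [G]; this
   gives continuity at boundary points of [K]. *)
have dphi0 y v : G y -> ~ K y -> 'd phi y v = 0.
  move=> Gy nKy; have phi0 : \forall z \near y, 0 = phi z.
    by apply: filterS2 (near_phi y Gy) (near_0 y nKy) => z -> <-.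
  have hphi := near_eq_is_diff phi0 (is_diff_cst 0 y).
  exact: (congr1 (fun l => l v) (@diff_val _ _ _ _ _ _ _ hphi)).
pose dpsi (x v : V) : V := if x \in K then 'd phi x v else 0.
exists psi => //; split; last by exists K.
  exists dpsi => [x|v x].
    have [Kx|nKx] := pselect (K x).
      rewrite (_ : dpsi x = 'd phi x); last by apply/funext => v; rewrite /dpsi mem_set.
      exact: near_eq_is_diff (near_phi x (KG x Kx)) (differentiableP (dphi x (KG x Kx))).
    rewrite (_ : dpsi x = fun=> 0); last by apply/funext => v; rewrite /dpsi memNset.
    exact: near_eq_is_diff (near_0 x nKx) (is_diff_cst 0 x).
  have [Kx|nKx] := pselect (K x).
    apply: (@near_eq_continuous _ _ (fun y => 'd phi y v)).
      apply: filterS (nearG x (KG x Kx)) => y Gy; rewrite /dpsi.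
      by case: ifPn => // /negP; rewrite inE => /(dphi0 y v Gy).
    by move: v; apply/continuous_jacobianP; exact: Jphi (KG x Kx).
  apply: (@near_eq_continuous _ _ (fun=> 0)); last exact: cst_continuous.
  by apply: filterS (near_off_compact cK nKx) => y nKy; rewrite /dpsi memNset.
move=> x; have [Kx|nKx] := pselect (K x).
  by rewrite psiG; [apply: phiw|]; exact: KG.
by rewrite psiK// enorm0.
Qed.

Lemma test_field_C1c w G psi : test_field w G psi -> C1c G psi.
Proof.
move=> [[dpsi hpsi cpsi] _ [K [cK KG] psiK]].
have supK : closure [set x | G x /\ psi x != 0] `<=` K.
  rewrite [X in _ `<=` X](closure_id K).1; last exact: compact_closed_rV.
  apply: closure_subset => x [_ /eqP psi0]; apply: contrapT => /psiK; exact: psi0.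
split.
- by move=> x _; case: (hpsi x).
- move=> x _; apply/continuous_jacobianP => v.
  rewrite (_ : (fun y => _) = fun y => dpsi y v); first exact: cpsi.
  by apply/funext => y; have [_ ->] := hpsi y.
- by apply: subclosed_compact cK supK; exact: closed_closure.
- exact: subset_trans supK KG.
Qed.

Definition flux (Om : set V) (g : V -> R) phi : \bar R :=
  (\int[leb]_(x in Om) (g x * divergence phi x)%:E)%E.

Lemma divergence_test_field0 w G phi (x : V) :
  test_field w G phi -> ~ G x -> divergence phi x = 0.
Proof.
move=> [_ _ [K [cK KG] phiK]] Gx; apply: divergence_near0.
by apply: filterS (near_off_compact cK (fun Kx => Gx (KG x Kx))) => y /phiK.
Qed.

Lemma flux_restrict w G (Om : set V) (g : V -> R) phi :
  G `<=` Om -> test_field w G phi ->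
  (\int[leb]_(x in G) (g x * divergence phi x)%:E)%E = flux Om g phi.
Proof.
move=> GOm tphi; rewrite /flux integral_mkcond [RHS]integral_mkcond.
apply: eq_integral => x _; rewrite /patch.
case: ifPn => [/set_mem Gx|/negP]; first by rewrite mem_set//; exact: GOm.
rewrite inE => nGx; rewrite (divergence_test_field0 tphi nGx) mulr0.
by case: ifP.
Qed.

(** Fields on the whole space, integrated over the fixed domain [Om], can be added and cut off
    without tracking [G]. *)
Lemma PEACE_test_field (Om G : set V) (f g : V -> R) (d : R) :
  open G -> G `<=` Om ->
  PEACE d f g G =
    ereal_sup [set flux Om g phi | phi in test_field (fun x => f x `^ (2 * d)) G].
Proof.
move=> oG GOm; congr (ereal_sup _); apply/seteqP; split => y /= [phi].
  move=> [C1phi phiw] <-{y}.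
  have [|psi tpsi psiG] := test_fieldP oG _ C1phi phiw.
    by move=> x; exact: powR_ge0.
  exists psi; first exact: tpsi.
  rewrite -(flux_restrict g GOm tpsi).
  apply: eq_integral => x /set_mem Gx; congr (_ * _)%:E.
  have [dphi _ _ _] := C1phi.
  apply: near_eq_divergence; first exact: dphi.
  by have : nbhs x G by [exact: open_nbhs_nbhs]; apply: filterS => y /psiG.
move=> tphi <-{y}; exists phi; last exact: flux_restrict tphi.
split; first exact: test_field_C1c tphi.
by case: tphi => _ + _ x _; exact.
Qed.

(** The divergence is continuous and vanishes off a compact set, hence is bounded, and the integrand
    is dominated by a multiple of [g]. *)
Lemma flux_integrable w G (Om : set V) (g : V -> R) phi :
  open Om -> leb.-integrable Om (EFin \o g) -> test_field w G phi ->
  leb.-integrable Om (fun x => (g x * divergence phi x)%:E).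
Proof.
move=> oOm gint tphi; have [C1phi _ [K [cK KG] phiK]] := tphi.
have mOm : measurable (Om : set (lebesgue_rV R n)) := open_measurable_rV oOm.
have cdiv := continuous_divergence C1phi.
have tK : test_field w K phi by case: tphi => ? ? _; split => //; exists K => //; split.
have [M [_ MK]] : bounded_set (divergence phi @` K).
  apply: compact_bounded; apply: continuous_compact cK.
  exact: continuous_subspaceT.
(* [MK] applies only to constants strictly above [M], whence the 1; the maximum with 0 serves the
   points off [K]. *)
pose C := Num.max 0 M + 1.
have divC x : `|divergence phi x| <= C.
  have C0 : 0 <= C by rewrite addr_ge0// le_max lexx.
  have [Kx|nKx] := pselect (K x); last by rewrite (divergence_test_field0 tK nKx) normr0.
  apply: MK; last by exists x.
  by rewrite ltr_pwDr// le_max lexx orbT.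
apply: (@le_integrable _ _ _ _ _ mOm _ (fun x => (C%:E * (EFin \o g) x)%E)).
- apply/measurable_EFinP; apply: measurable_funM.
    exact/measurable_EFinP/(measurable_int _ gint).
  exact: continuous_measurable_rV.
- move=> x _; rewrite /= lee_fin normrM mulrC normrM ler_wpM2r//.
  by rewrite (le_trans (divC x))// ler_norm.
- exact: integrableZl.
Qed.

Lemma fluxD w1 w2 G1 G2 (Om : set V) (g : V -> R) phi psi :
  open Om -> leb.-integrable Om (EFin \o g) ->
  test_field w1 G1 phi -> test_field w2 G2 psi ->
  flux Om g (fun x => phi x + psi x) = (flux Om g phi + flux Om g psi)%E.
Proof.
move=> oOm gint tphi tpsi.
have mOm : measurable (Om : set (lebesgue_rV R n)) := open_measurable_rV oOm.
rewrite /flux -integralD//; [|exact: flux_integrable tphi|exact: flux_integrable tpsi].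
apply: eq_integral => x _; rewrite -EFinD -mulrDr divergenceD//.
  by case: tphi.
by case: tpsi.
Qed.

End test_field.

(** * Weighted variation as a set function *)

Section variation.
Context {R : realType} {n : nat}.
Local Notation V := 'rV[R]_n.+1.
Local Notation leb := (lebesgue_measure_rV R n).
Variables (Om : set V) (g w : V -> R).
Hypotheses (oOm : open Om) (gint : leb.-integrable Om (EFin \o g)).
Hypothesis w_ge0 : forall x, 0 <= w x.
Implicit Types (G K : set V) (phi psi : V -> V).
Local Open Scope ereal_scope.

(** The total variation of [g] on [G] with weight [w]. *)
Definition variation G : \bar R := ereal_sup [set flux Om g phi | phi in test_field w G].

Lemma flux_le_variation G phi : test_field w G phi -> flux Om g phi <= variation G.
Proof. by move=> tphi; apply: ereal_sup_ubound; exists phi. Qed.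

Lemma flux_fin_num G phi : test_field w G phi -> flux Om g phi \is a fin_num.
Proof.
move=> tphi; apply: integrable_fin_num; first exact: open_measurable_rV.
exact: flux_integrable tphi.
Qed.

Lemma flux_test_field0 phi : test_field w set0 phi -> flux Om g phi = 0.
Proof.
move=> tphi; apply: integral0_eq => x _.
by rewrite (divergence_test_field0 tphi) ?mulr0//; case.
Qed.

Lemma variation_ge0 G : 0 <= variation G.
Proof.
rewrite -(flux_test_field0 (test_field0 set0 w_ge0)).
by apply: flux_le_variation; exact: test_field0.
Qed.

Lemma variation0 : variation set0 = 0.
Proof.
apply/eqP; rewrite eq_le variation_ge0 andbT.
by apply: ge_ereal_sup => _ [phi tphi <-]; rewrite flux_test_field0.
Qed.

Lemma variationU G1 G2 : open G1 -> open G2 ->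
  variation (G1 `|` G2) <= variation G1 + variation G2.
Proof.
move=> oG1 oG2; apply: ge_ereal_sup => _ [phi tphi <-].
have [C1phi phiw [K [cK KG] phiK]] := tphi.
(* The part of the support outside [G2] is a compact subset of [G1]. With [z = 1] on a neighbourhood
   [U] of it, [(1 - z) phi] lives on [K] minus [U], a compact subset of [G2]. *)
have cK1 : compact (K `&` ~` G2).
  by apply: compact_closedI => //; exact: open_closedC.
have K1G1 : K `&` ~` G2 `<=` G1 by move=> x [/KG[]].
have [U [z [oU KU [C1z z01 zU [Kz [cKz KzG1] zKz]]]]] := exists_cutoff oG1 cK1 K1G1.
have C1z' : C1 (fun x => 1 - z x)%R.
  apply: C1D; first exact: C1_cst.
  rewrite (_ : (fun x => _) = fun x => -1 * z x)%R; last first.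
    by apply/funext => x; rewrite mulN1r.
  by apply: C1M; first exact: C1_cst.
have t1 : test_field w G1 (fun x => z x *: phi x)%R.
  split; first exact: C1Z.
    by move=> x; apply: le_trans (phiw x); exact: enormZ_le.
  by exists Kz => // x /zKz ->; rewrite scale0r.
have t2 : test_field w G2 (fun x => (1 - z x) *: phi x)%R.
  split; first exact: C1Z.
    move=> x; apply: le_trans (phiw x); apply: enormZ_le.
    by have /andP[? ?] := z01 x; apply/andP; split; lra.
  exists (K `&` ~` U).
    split; first by apply: compact_closedI => //; exact: open_closedC.
    by move=> x [Kx nUx]; apply: contrapT => nG2; apply: nUx; exact: KU.
  move=> x /not_andP[/phiK ->|/contrapT/zU ->]; first by rewrite scaler0.
  by rewrite subrr scale0r.
rewrite (_ : phi = fun x => z x *: phi x + (1 - z x) *: phi x)%R; last first.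
  by apply/funext => x; rewrite -scalerDl addrC subrK scale1r.
rewrite (fluxD oOm gint t1 t2).
by apply: leeD; exact: flux_le_variation.
Qed.

Lemma variation_bigcup (G : (set V)^nat) : (forall k, open (G k)) ->
  variation (\bigcup_k G k) <= \sum_(k <oo) variation (G k).
Proof.
move=> oG; apply: ge_ereal_sup => _ [phi [C1phi phiw [K [cK KG] phiK]] <-].
have [N KN] : exists N, K `<=` \big[setU/set0]_(k < N) G k.
  have [D _ KD] : finite_subset_cover [set: nat] G K.
    by move: cK; rewrite compact_cover; apply => // x /KG.
  (* The union over [k < N] is strict, hence the successor of the largest index in the subcover. *)
  exists (\max_(k <- finmap.enum_fset D) k).+1 => x /KD[k /= kD Gkx].
  rewrite -bigcup_mkord; exists k => //=; rewrite ltnS.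
  by apply: (@leq_bigmax_seq _ _ xpredT id); first exact: kD.
apply: (@le_trans _ _ (variation (\big[setU/set0]_(k < N) G k))).
  by apply: flux_le_variation; split => //; exists K.
apply: (@le_trans _ _ (\sum_(0 <= k < N) variation (G k))); last first.
  by apply: nneseries_lim_ge => k _ _; exact: variation_ge0.
elim: N {KN} => [|N IHN]; first by rewrite big_ord0 big_nil variation0.
rewrite big_ord_recr big_nat_recr//=; apply: le_trans (leeD2r _ IHN).
by apply: variationU => //; rewrite -bigcup_mkord; exact: bigcup_open.
Qed.

(** The supports of [phi] and of a field in [A] minus [K] are disjoint, so at each point at most one
    summand is nonzero and the sum keeps the bound [w]. *)
Lemma flux_variation_le A G K phi : compact K -> K `<=` A ->
  C1 phi -> (forall x, enorm (phi x) <= w x)%R -> (forall x, ~ K x -> phi x = 0%R) ->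
  flux Om g phi + variation (A `\` K) <= variation A.
Proof.
move=> cK KA C1phi phiw phiK.
have tphi : test_field w A phi by split => //; exists K.
(* The flux of [phi] is finite and can change sides, which leaves a supremum over [psi] to bound. *)
rewrite addeC -leeBrDr; last exact: flux_fin_num tphi.
apply: ge_ereal_sup => _ [psi tpsi <-].
rewrite leeBrDr; last exact: flux_fin_num tphi.
rewrite -(fluxD oOm gint tpsi tphi); apply: flux_le_variation.
have [C1psi psiw [L [cL LA] psiL]] := tpsi.
split; first exact: C1D.
  move=> x; have [Kx|/phiK ->] := pselect (K x); last by rewrite addr0.
  by rewrite psiL ?add0r// => /LA[].
exists (L `|` K).
  by split; [exact: compactU|move=> x [/LA[]//|/KA]].
by move=> x /not_orP[/psiL -> /phiK ->]; rewrite addr0.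
Qed.

End variation.

(** * The outer measure, its measurable sets and Borel regularity *)

Section outer.
Context {R : realType} {n : nat}.
Local Notation V := 'rV[R]_n.+1.
Local Notation leb := (lebesgue_measure_rV R n).
Variables (Om : set V) (f g : V -> R) (d : R).
Hypotheses (oOm : open Om) (gint : leb.-integrable Om (EFin \o g)).
Local Notation lam := (variation Om g (fun x => f x `^ (2 * d))).
Local Notation mu := (@PEACE_outer R n d Om f g).
Local Open Scope ereal_scope.

Let w_ge0 (x : V) : (0 <= f x `^ (2 * d))%R. Proof. exact: powR_ge0. Qed.

Lemma PEACE_outerE (E : set (set_type Om)) : mu E = ereal_inf [set lam G
  | G in [set G | [/\ open G, G `<=` Om & set_val @` E `<=` G]]].
Proof.
congr (ereal_inf _); apply/seteqP; split => y /= [G [oG GOm EG] <-]; exists G => //;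
  by rewrite /variation -PEACE_test_field.
Qed.

Lemma PEACE_outer_le (E : set (set_type Om)) G :
  open G -> G `<=` Om -> set_val @` E `<=` G -> mu E <= lam G.
Proof. by move=> oG GOm EG; rewrite PEACE_outerE; apply: ereal_inf_lbound; exists G. Qed.

Lemma PEACE_outer_approx (E : set (set_type Om)) (e : R) :
  (0 < e)%R -> mu E \is a fin_num ->
  exists G, [/\ open G, G `<=` Om, set_val @` E `<=` G & lam G < mu E + e%:E].
Proof.
move=> e0; rewrite PEACE_outerE => /(lb_ereal_inf_adherent e0).
by move=> [_ [G [oG GOm EG] <-] Ge]; exists G.
Qed.

Lemma PEACE_outer_ge0 (E : set (set_type Om)) : 0 <= mu E.
Proof.
rewrite PEACE_outerE; apply: le_ereal_inf_tmp => _ [G _ <-].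
exact: variation_ge0.
Qed.

Lemma PEACE_outer0 : mu set0 = 0.
Proof.
apply/eqP; rewrite eq_le PEACE_outer_ge0 andbT.
rewrite -(variation0 Om g w_ge0); apply: PEACE_outer_le.
- exact: open0.
- exact: sub0set.
- by rewrite image_set0.
Qed.

Lemma le_PEACE_outer : {homo mu : A B / A `<=` B >-> A <= B}.
Proof.
move=> A B AB; rewrite !PEACE_outerE; apply: ereal_inf_le_tmp => _ [G [oG GOm BG] <-].
by exists G => //; split => //; apply: subset_trans BG; exact: image_subset.
Qed.

Lemma PEACE_outer_sigma_subadditive : sigma_subadditive mu.
Proof.
(* An infinite term makes the bound trivial; otherwise each [A k] has an open superset within
   [e / 2 ^ k.+1] of its outer measure. *)
move=> A; have [[i ioo]|] := pselect (exists i, mu (A i) = +oo).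
  rewrite (eseries_pinfty _ _ ioo) ?leey// => k _.
  by rewrite -ltNye (lt_le_trans _ (PEACE_outer_ge0 _)).
rewrite -forallNE => Aoo.
apply/lee_addgt0Pr => e e0.
rewrite (le_trans _ (epsilon_trick _ _ (ltW e0)))//; last first.
  by move=> k; exact: PEACE_outer_ge0.
have /choice[G hG] k : exists G, [/\ open G, G `<=` Om, set_val @` A k `<=` G &
    lam G < mu (A k) + (e / (2 ^ k.+1)%:R)%:E].
  apply: PEACE_outer_approx; first by rewrite divr_gt0// ltr0n expn_gt0.
  by rewrite ge0_fin_numE ?PEACE_outer_ge0// ltey; apply/eqP; exact: Aoo.
have oG k : open (G k) by have [] := hG k.
apply: (@le_trans _ _ (lam (\bigcup_k G k))).
  apply: PEACE_outer_le; first exact: bigcup_open.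
    by apply: bigcup_sub => k _; have [] := hG k.
  by move=> _ [x [k _ Akx] <-]; exists k => //; have [_ _ + _] := hG k; apply; exists x.
apply: le_trans (variation_bigcup oOm gint w_ge0 oG) _.
apply: lee_nneseries => k _; first by move=> _; exact: variation_ge0.
by have [_ _ _ /ltW] := hG k.
Qed.

Definition PEACE_outer_measure : {outer_measure set (set_type Om) -> \bar R} :=
  HB.pack (mu : set (set_type Om) -> \bar R)
    (isOuterMeasure.Build R (set_type Om) mu PEACE_outer0 PEACE_outer_ge0
      le_PEACE_outer PEACE_outer_sigma_subadditive).

Lemma open_caratheodory (B : set (set_type Om)) : open B -> mu.-caratheodory B.
Proof.
(* An open set of the subtype is the trace of an open [W]; only the superadditive inequality has to
   be shown, for each open [A] containing the test set. *)
move=> [W oW WB]; apply: (le_caratheodory_measurable (mu := PEACE_outer_measure)) => X.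
rewrite /= [leRHS]PEACE_outerE; apply: le_ereal_inf_tmp => _ [A [oA AOm XA] <-].
apply: (@le_trans _ _ (lam (A `&` W) + mu (X `&` ~` B))).
  apply: leeD2r; apply: PEACE_outer_le; first exact: openI.
    by move=> x [/AOm].
  move=> _ [x [Xx Bx] <-]; split; first by apply: XA; exists x.
  by move: Bx; rewrite -WB.
(* [A] minus [K] is open and contains the part of [X] outside [B], since [K] lies in [W]. *)
have key phi : test_field (fun x => f x `^ (2 * d))%R (A `&` W) phi ->
    flux Om g phi + mu (X `&` ~` B) <= lam A.
  move=> [C1phi phiw [K [cK KAW] phiK]].
  have KA : K `<=` A by move=> x /KAW[].
  apply: le_trans (flux_variation_le oOm gint A cK KA C1phi phiw phiK).
  apply: leeD2l; apply: PEACE_outer_le.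
  - rewrite setDE; apply: openI; first exact: oA.
    apply: closed_openC; exact: compact_closed_rV.
  - by move=> x [/AOm].
  - move=> _ [x [Xx Bx] <-]; split; first by apply: XA; exists x.
    by move=> /KAW[_ Wx]; apply: Bx; rewrite -WB.
have := PEACE_outer_ge0 (X `&` ~` B).
(* A finite value can be subtracted before taking the supremum over [phi]; for [+oo], the zero field
   already forces [lam A = +oo]. *)
move: (mu (X `&` ~` B)) key => [r| |//] key _.
  rewrite -leeBrDr//; apply: ge_ereal_sup => _ [phi tphi <-].
  by rewrite leeBrDr//; exact: key.
have := key _ (test_field0 _ w_ge0).
rewrite addey ?leye_eq; last by rewrite (flux_test_field0 Om g (test_field0 set0 w_ge0)).
by move=> /eqP ->; rewrite leey.
Qed.

(** The Caratheodory measurable sets form a sigma-algebra, and it contains the open sets. *)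
Lemma borel_caratheodory (B : set (set_type Om)) : borel_set B -> mu.-caratheodory B.
Proof.
move: B; apply: smallest_sub; last by move=> B /open_caratheodory.
split.
- exact: (caratheodory_measurable_set0 PEACE_outer_measure).
- move=> A mA; rewrite setTD.
  exact: (@caratheodory_measurable_setC _ _ PEACE_outer_measure).
- by move=> F mF; exact: (@caratheodory_measurable_bigcup _ _ PEACE_outer_measure).
Qed.

Lemma PEACE_outer_sigma_additive (B : (set (set_type Om))^nat) :
  (forall k, borel_set (B k)) -> trivIset setT B ->
  mu (\bigcup_k B k) = \sum_(k <oo) mu (B k).
Proof.
move=> bB tB; apply/eqP; rewrite eq_le PEACE_outer_sigma_subadditive/=.
have mB k : PEACE_outer_measure.-caratheodory (B k).
  by apply: borel_caratheodory; exact: bB.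
(* The Caratheodory inequality is tested on the union itself, so the remainder term is [mu set0]. *)
have := caratheodory_lime_le mB tB (\bigcup_k B k).
rewrite setICr /= PEACE_outer0 adde0; apply: le_trans.
by apply: lee_nneseries => k _ //; [move=> _; exact: PEACE_outer_ge0|
  apply: le_PEACE_outer => x Bx; split => //; exists k].
Qed.

Lemma PEACE_outer_borel_regular (A : set (set_type Om)) :
  exists E, borel_set E /\ mu A = mu E.
Proof.
have borelC (E : set (set_type Om)) : borel_set E -> borel_set (~` E).
  by move=> bE; rewrite -setTD; exact: sigma_algebraCD.
have [Aoo|] := eqVneq (mu A) +oo.
  exists (~` set0); split; first by apply: (borelC); exact: sigma_algebra0.
  by apply/eqP; rewrite setC0 eq_le le_PEACE_outer//= Aoo leey.
rewrite -ltey -ge0_fin_numE ?PEACE_outer_ge0// => Afin.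
have /choice[G hG] (k : nat) : exists G, [/\ open G, G `<=` Om, set_val @` A `<=` G &
    lam G < mu A + k.+1%:R^-1%:E] by exact: PEACE_outer_approx.
(* A countable intersection of open sets whose variations tend to [mu A]. *)
pose E : set (set_type Om) := \bigcap_k (set_val @^-1` G k).
exists E; split.
  rewrite /E -[X in borel_set X]setCK setC_bigcap; apply: (borelC).
  apply: sigma_algebra_bigcup => k; apply: (borelC); apply: sub_sigma_algebra.
  by have [oG _ _ _] := hG k; exists (G k).
apply/eqP; rewrite eq_le; apply/andP; split.
  by apply: le_PEACE_outer => x Ax k _; have [_ _ + _] := hG k; apply; exists x.
apply/lee_addgt0Pr => e e0.
(* Then [e^-1 < k.+1], so the error [k.+1%:R^-1] is at most [e]. *)
pose k := Num.truncn e^-1.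
have [oG GOm _ /ltW lamG] := hG k.
apply: le_trans (le_trans lamG _); last first.
  rewrite leeD2l// lee_fin invf_ple ?posrE// ltW//.
  exact: truncnS_gt.
by apply: PEACE_outer_le => // _ [x Ex <-]; exact: Ex.
Qed.

End outer.

Theorem theorem4p4 (R : realType) (n : nat)
    (Om : set 'rV[R]_n.+1) (hOm : open Om)
    (g : 'rV[R]_n.+1 -> R)
    (hg : (lebesgue_measure_rV R n).-integrable Om (EFin \o g))
    (dT : measure_display) (T : measurableType dT) (P : probability T R)
    (X : {RV P >-> borel_rV R n}) (hX : forall t, Om (X t))
    (f : 'rV[R]_n.+1 -> R) (hf : is_pdf_on X Om f)
    (Y : T -> R) (hY : forall t, Y t = g (X t))
    (d : R) (hd : 0 <= d) :
  let mu : set (set_type Om) -> \bar R := @PEACE_outer R n d Om f g in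
  [/\ exists m : {outer_measure set (set_type Om) -> \bar R},
        forall E, m E = mu E,
      forall B : set (set_type Om), borel_set B -> mu.-caratheodory B,
      forall B : (set (set_type Om))^nat, (forall k, borel_set (B k)) ->
        trivIset setT B ->
        mu (\bigcup_k B k) = (\sum_(k <oo) mu (B k))%E
    & forall A : set (set_type Om), exists E : set (set_type Om),
        borel_set E /\ mu A = mu E].
Proof.
move=> mu; split.
- by exists (PEACE_outer_measure f d hOm hg).
- exact: borel_caratheodory.
- exact: PEACE_outer_sigma_additive.
- exact: PEACE_outer_borel_regular.
Qed.
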